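(* Let $g$ be a scalar product on the linear space of mappings $\mathcal{H}:=\{T \mid T:\mathcal{D}\to\mathbb{R}^d\}$ such that $(\mathcal{H},g)$ is a Hilbert space. Let $J$ be a shape functional, defined on shapes $\Omega=T(\Omega^0)$, and let $f(T):=J(T(\Omega^0))$ for $T\in\mathcal{H}$. For any invertible $T\in\mathcal{H}$ let $b(Z_1,Z_2)_T:=g(Z_1\circ T,Z_2\circ T)$ for $Z_1,Z_2\in\mathcal{H}$, and let $\nabla J(\Omega)=\nabla J(T)\in\mathcal{H}$, $\Omega=T(\Omega^0)$, be defined by $b(\nabla J(T),Z)_T=dJ(\Omega)[Z]$ for all $Z\in\mathcal{H}$. Let an invertible $T\in\mathcal{H}$ be given, put $\Omega=T(\Omega^0)$, and assume for the vector field $V$ defined on $\mathcal{D}$ that $I+V:\mathcal{D}\to\mathcal{D}$ is invertible and that $(I+V)\circ T\in\mathcal{H}$. Furthermore, assume that $f$ is three times differentiable with bounded third derivative. Then there holds the Taylor series $$J(\Omega+V(\Omega))=J(\Omega)+b(\nabla J(\Omega),V)_T+\frac12 J''(\Omega)[V,V]+\mathcal{O}(\|V\|^3),$$ where $\mathcal{O}$ denotes the Landau symbol, the norm $\|\cdot\|$ is derived from the scalar product $b(\cdot,\cdot)_T$, and $J''(\Omega)[V,W]$ is the linear second shape derivative defined by $$J''(\Omega)[V,W]:=\frac{d}{ds_1}\Big|_{s_1=0^+}\ \frac{d}{ds_2}\Big|_{s_2=0^+}\ J\big((I+s_1V+s_2W)(\Omega)\big).$$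
   Context: $\mathcal{D}\subset\mathbb{R}^d$ is a fixed hold-all domain and $\Omega^0\subset\mathcal{D}$ is a fixed initial shape (a bounded Lipschitz domain). Shapes are the deformed sets $\Omega=T(\Omega^0)=\{T(x):x\in\Omega^0\}$ for mappings $T$ defined on $\mathcal{D}$. An invertible $T\in\mathcal{H}$ means a deformation representing a shape, i.e. a bijection $T:\mathcal{D}\to\mathcal{D}$; for such $T$ and $Z\in\mathcal{H}$ the compositions $Z\circ T$ and $Z\circ T^{-1}$ are elements of $\mathcal{H}$. $I$ is the identity map, and $\Omega+V(\Omega)$ denotes $(I+V)(\Omega)=\{x+V(x):x\in\Omega\}$, so that $J(\Omega+V(\Omega))=f((I+V)\circ T)=f(T+V\circ T)$. The shape derivative is $dJ(\Omega)[Z]:=\lim_{t\to0^+}\frac1t\big(J((I+tZ)(\Omega))-J(\Omega)\big)$; $J$ is assumed shape differentiable, meaning that this limit exists for all $Z$ and is linear and continuous in $Z$. It satisfies $dJ(\Omega)[Z]=f'(T)[Z\circ T]$ for $\Omega=T(\Omega^0)$. The norm is $\|V\|=\sqrt{b(V,V)_T}$. Differentiability of $f$ is understood on the Hilbert space $(\mathcal{H},g)$. *)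

(* Defs.v *)
From HB Require Import structures.
From mathcomp Require Import all_boot all_order all_algebra.
From mathcomp Require Import sesquilinear.
From mathcomp Require Import all_classical all_reals all_analysis.

Set Implicit Arguments.
Unset Strict Implicit.
Unset Printing Implicit Defensive.

Import Order.TTheory GRing.Theory Num.Theory.
Import numFieldNormedType.Exports.

Local Open Scope classical_set_scope.
Local Open Scope ring_scope.

(* The ambient space is 'rV[R]_d.+1, so the dimension d.+1 is at least 1; the
   hold-all D is used as a type, and mappings on D are functions out of it. *)

Definition domain (R : realType) (d : nat) (A : set 'rV[R]_d.+1) : Prop :=
  [/\ A !=set0, open A & connected A].

(* Near each boundary point, and in Cartesian coordinates x *m Q rotated by an
   orthogonal Q, the set is the strict epigraph of a Lipschitz function of the
   first d coordinates. *)
Definition lipschitz_boundary (R : realType) (d : nat)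
    (A : set 'rV[R]_d.+1) : Prop :=
  forall p, (closure A `\` A°) p ->
    exists (Q : 'M[R]_d.+1) (gamma : 'rV[R]_d -> R),
      [/\ Q *m Q^T = 1%:M, lipschitz gamma &
          \forall x \near p,
            A x <-> gamma (col' ord_max (x *m Q)) < (x *m Q) 0 ord_max].

Definition bounded_lipschitz_domain (R : realType) (d : nat)
    (A : set 'rV[R]_d.+1) : Prop :=
  [/\ domain A, bounded_set A & lipschitz_boundary A].

(* A Hilbert space of mappings on D: a complete normed space whose norm comes
   from the scalar product [hdot], together with an injective linear map
   [hmap] identifying its elements with mappings D -> R^d.+1. *)
Record hilbertMaps (R : realType) (d : nat) (D : set 'rV[R]_d.+1) :=
  HilbertMaps {
    hspace :> completeNormedModType R;
    hmap : {linear hspace -> (D -> 'rV[R]_d.+1)};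
    hmap_inj : injective hmap;
    hdot : {dot hspace for idfun};
    hdot_norm : forall S : hspace, `|S| = Num.sqrt (hdot S S)
  }.

Section Shapes.
Variables (R : realType) (d : nat) (D : set 'rV[R]_d.+1).

Local Notation map_on_D := (D -> 'rV[R]_d.+1).

(* F(A), for A contained in D *)
Definition map_image (F : map_on_D) (A : set 'rV[R]_d.+1) :
    set 'rV[R]_d.+1 :=
  F @` [set x | A (val x)].

(* Derivative from the right at 0; a junk value when the limit does not exist. *)
Definition rquot (phi : R -> R) (t : R) : R := t^-1 * (phi t - phi 0).
Definition rderivable0 (phi : R -> R) : Prop := cvg (rquot phi t @[t --> 0^'+]).
Definition rderive0 (phi : R -> R) : R := lim (rquot phi t @[t --> 0^'+]).

Variable J : set 'rV[R]_d.+1 -> R.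

Definition shape_quot (Omega : set 'rV[R]_d.+1) (Z : map_on_D) (t : R) : R :=
  t^-1 * (J (map_image (fun x => val x + t *: Z x) Omega) - J Omega).

Definition shape_derive (Omega : set 'rV[R]_d.+1) (Z : map_on_D) : R :=
  lim (shape_quot Omega Z t @[t --> 0^'+]).

Definition perturbed (Omega : set 'rV[R]_d.+1) (V W : map_on_D) (s1 s2 : R) : R :=
  J (map_image (fun x => val x + s1 *: V x + s2 *: W x) Omega).

Definition shape_derive2 (Omega : set 'rV[R]_d.+1) (V W : map_on_D) : R :=
  rderive0 (fun s1 => rderive0 (perturbed Omega V W s1)).

Definition shape_derivable2 (Omega : set 'rV[R]_d.+1) (V W : map_on_D) : Prop :=
  [/\ rderivable0 (perturbed Omega V W 0),
      \forall s1 \near 0^'+, rderivable0 (perturbed Omega V W s1) &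
      rderivable0 (fun s1 => rderive0 (perturbed Omega V W s1))].

Variable H : hilbertMaps D.

(* The element of H that F is, when F belongs to H; 0 otherwise. *)
Definition in_hspace (F : map_on_D) : Prop := exists S : H, hmap H S = F.
Definition to_hspace (F : map_on_D) : H := xget 0 [set S : H | hmap H S = F].

(* T is invertible: tau is T seen as a bijection of D onto itself. *)
Definition invertible (T : H) (tau : D -> D) : Prop :=
  bijective tau /\ forall x, hmap H T x = val (tau x).

Definition composition_closed : Prop :=
  forall (T : H) (tau : D -> D), invertible T tau -> forall Z : H,
    in_hspace (hmap H Z \o tau) /\
    forall tau' : D -> D, cancel tau tau' -> cancel tau' tau ->
      in_hspace (hmap H Z \o tau').

Definition shape_differentiable (Omega0 : set 'rV[R]_d.+1) : Prop :=
  forall (T : H) (tau : D -> D), invertible T tau ->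
    let Omega := map_image (hmap H T) Omega0 in
    let dJ (Z : H) := shape_derive Omega (hmap H Z) in
    [/\ forall Z : H, cvg (shape_quot Omega (hmap H Z) t @[t --> 0^'+]),
        scalar dJ & continuous dJ].

Definition bform (tau : D -> D) (Z1 Z2 : map_on_D) : R :=
  hdot H (to_hspace (Z1 \o tau)) (to_hspace (Z2 \o tau)).

Definition bnorm (tau : D -> D) (V : map_on_D) : R := Num.sqrt (bform tau V V).

Definition is_shape_gradient (Omega : set 'rV[R]_d.+1) (tau : D -> D) (G : H) :
    Prop :=
  forall Z : H, bform tau (hmap H G) (hmap H Z) = shape_derive Omega (hmap H Z).

Definition reduced (Omega0 : set 'rV[R]_d.+1) (T : H) : R :=
  J (map_image (hmap H T) Omega0).

(* The vector fields V with I + V : D -> D invertible and (I + V) o T in H. *)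
Definition admissible (tau : D -> D) (V : map_on_D) : Prop :=
  (exists2 sigma : D -> D, bijective sigma &
     forall x, val (sigma x) = val x + V x) /\
  in_hspace (fun x => val (tau x) + V (tau x)).

(* The filter of admissible fields V with bnorm tau V tending to 0. *)
Definition small_fields (tau : D -> D) : set_system map_on_D :=
  filter_from [set e : R | 0 < e]
    (fun e => [set V | admissible tau V /\ bnorm tau V < e]).

#[global] Instance small_fields_filter (tau : D -> D) :
  Filter (small_fields tau).
Proof.
apply: filter_from_filter; first by exists 1; exact: ltr01.
move=> a b a0 b0; exists (Order.min a b); first by rewrite /= lt_min a0 b0.
by move=> V [Vadm]; rewrite lt_min => /andP[Va Vb].
Qed.

Canonical small_fields_filter_on (tau : D -> D) :=
  FilterType (small_fields tau) (small_fields_filter tau).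

End Shapes.

(* Second and third Frechet derivatives are bounded multilinear forms, and the
   remainders are measured in the operator norm (uniformly in z, resp. y z). *)
Section Frechet.
Variables (R : realType) (H : normedModType R).

Definition is_diff2 (f : H -> R) (f2 : H -> H -> H -> R) : Prop :=
  forall T : H,
  [/\ forall z, scalar (fun h => f2 T h z),
      forall h, scalar (f2 T h),
      exists M : R, forall h z, `|f2 T h z| <= M * `|h| * `|z| &
      forall e : R, 0 < e -> \forall h \near (0 : H), forall z,
        `|'d f (T + h) z - 'd f T z - f2 T h z| <= e * `|h| * `|z|].

Definition is_diff3 (f2 : H -> H -> H -> R) (f3 : H -> H -> H -> H -> R) :
    Prop :=
  forall T : H,
  [/\ forall y z, scalar (fun h => f3 T h y z),
      forall h z, scalar (fun y => f3 T h y z),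
      forall h y, scalar (f3 T h y),
      exists M : R, forall h y z, `|f3 T h y z| <= M * `|h| * `|y| * `|z| &
      forall e : R, 0 < e -> \forall h \near (0 : H), forall y z,
        `|f2 (T + h) y z - f2 T y z - f3 T h y z| <= e * `|h| * `|y| * `|z|].

Definition thrice_differentiable_bounded (f : H -> R) : Prop :=
  (forall T : H, differentiable f T) /\
  exists (f2 : H -> H -> H -> R) (f3 : H -> H -> H -> H -> R),
    [/\ is_diff2 f f2, is_diff3 f2 f3 &
        exists M : R, forall T h y z : H,
          `|f3 T h y z| <= M * `|h| * `|y| * `|z|].

End Frechet.

(* Main.v *)
Require Import Defs.
From HB Require Import structures.
From mathcomp Require Import all_boot all_order all_algebra.
From mathcomp Require Import all_classical all_reals all_analysis.
From mathcomp Require Import ring.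
Set Implicit Arguments.
Unset Strict Implicit.
Unset Printing Implicit Defensive.
Import Order.TTheory GRing.Theory Num.Theory.
Import numFieldNormedType.Exports.
Local Open Scope classical_set_scope.
Local Open Scope ring_scope.

(** On an invertible [T] the whole statement is a Taylor expansion of the
    reduced functional [f = reduced J Omega0] on the Hilbert space.

    Since [Omega = T(Omega0)], the perturbed shape [(I + W)(Omega)] is
    [(T + W o T)(Omega0)]; so if [h] is the element of the Hilbert space that
    represents [V o T], then [J] of [(I + s V)(Omega)] is [f (T + s h)]
    ([reduced_perturbation]).  For an admissible [V] such an [h] exists: it is
    the difference of [(I + V) o T] and [T] ([admissible_pullback]).  Moreover
    [V] is itself in the Hilbert space, being [h o T^-1], so the gradient may be
    tested against it.  The terms of the claim become, in this order,
    [f (T + h)], [f T], ['d f T h] and [f2 T h h], with [f2] the second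
    derivative of [f]; and the norm of [V] is the Hilbert norm of [h].

    It remains to expand [phi s = f (T + s h)] on [0, 1].  Derivatives of [f] up
    to order three restrict to ordinary derivatives of [phi] ([is_derive_line]),
    the third one being at most [M * |h| ^ 3] with [M] independent of [h]; three
    applications of the mean value theorem bound the remainder by the same
    quantity ([taylor2_remainder_le]). *)

(** * Functions of one real variable *)

Lemma increment_le (R : realType) (q dq : R -> R) (K : R) :
  (forall t : R, is_derive t 1 q (dq t)) ->
  (forall t : R, 0 <= t <= 1 -> `|dq t| <= K) ->
  forall t : R, 0 <= t <= 1 -> `|q t - q 0| <= K.
Proof.
move=> dqE dqK t /andP[t0 t1].
have qC : {within `[0, t], continuous q}.
  apply: derivable_within_continuous => x _.
  by case: (dqE x).
have [c] := MVT_segment t0 (fun x _ => dqE x) qC.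
rewrite in_itv /= => /andP[c0 ct] ->.
have c01 : 0 <= c <= 1 by rewrite c0 (le_trans ct).
rewrite subr0 normrM (ger0_norm t0).
by rewrite (le_trans (ler_piMr _ t1)) ?dqK.
Qed.

(** Subtracting from [p0] its Taylor polynomial, and from [p1], [p2] the
    derivatives of that polynomial, gives functions vanishing at 0; a bound on
    [p3] is then passed down through [p2], [p1] and [p0]. *)
Lemma taylor2_remainder_le (R : realType) (p0 p1 p2 p3 : R -> R) (K : R) :
  (forall t : R, is_derive t 1 p0 (p1 t)) ->
  (forall t : R, is_derive t 1 p1 (p2 t)) ->
  (forall t : R, is_derive t 1 p2 (p3 t)) ->
  (forall t : R, 0 <= t <= 1 -> `|p3 t| <= K) ->
  `|p0 1 - (p0 0 + p1 0 + 2^-1 * p2 0)| <= K.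
Proof.
move=> d0 d1 d2 b3.
have b2 := increment_le d2 b3.
have d1' (t : R) : is_derive t 1 (fun s => p1 s - s * p2 0) (p2 t - p2 0).
  by apply: is_derive_eq; rewrite scaler0 add0r [(p2 0)%:A]mulr1.
have b1 := increment_le d1' b2.
have d0' (t : R) : is_derive t 1
    (fun s => p0 s - s * p1 0 - 2^-1 * s ^+ 2 * p2 0)
    (p1 t - t * p2 0 - (p1 0 - 0 * p2 0)).
  apply: is_derive_eq => /=.
  by rewrite /GRing.scale /=; field.
have /= := increment_le d0' b1 (t := 1).
rewrite ler01 lexx expr1n expr0n /= !(mul0r, mulr0, subr0, mul1r, mulr1).
move=> /(_ erefl) b0; apply: le_trans b0; rewrite le_eqVlt; apply/orP; left.
by apply/eqP; congr (`| _ |); ring.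
Qed.

Lemma rquot_cvg (R : realType) (psi : R -> R) (s l : R) :
  is_derive s 1 psi l ->
  rquot (fun t => psi (s + t)) t @[t --> 0^'+] --> l.
Proof.
move=> [psi_s <-]; apply: cvg_dnbhs_at_right.
rewrite (_ : rquot _ = fun k => k^-1 *: ((psi \o shift s) (k *: 1) - psi s)).
  exact: psi_s.
by apply/funext => t; rewrite /rquot /= addr0 [t%:A]mulr1 (addrC t).
Qed.

Lemma rderive0_shift (R : realType) (psi : R -> R) (s l : R) :
  is_derive s 1 psi l -> rderive0 (fun t => psi (s + t)) = l.
Proof. by move=> /rquot_cvg; apply: cvg_lim. Qed.

(** * Restriction of Frechet derivatives to lines *)

(** A tolerance divided by [a + 1] rather than by [a] survives [a = 0]; below,
    [a] is the norm of a direction. *)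
Lemma divr_add1_mul_le (R : realFieldType) (e a : R) :
  0 <= e -> 0 <= a -> e / (a + 1) * a <= e.
Proof.
move=> e0 a0; have a1 : 0 < a + 1 by rewrite ltr_wpDl.
by rewrite mulrAC ler_pdivrMr // ler_wpM2l // lerDl.
Qed.

(** Stated for a function [F] and a form [L] rather than for ['d F], so that it
    applies to [f], to ['d f] at a fixed vector and to [f2] at two fixed
    vectors, the derivative of each being given by a remainder estimate. *)
Lemma is_derive_line (R : realType) (H : normedModType R) (F L : H -> R)
    (T h : H) (t : R) :
  scalar L ->
  (forall e, 0 < e -> \forall k \near (0 : H),
     `|F (T + t *: h + k) - F (T + t *: h) - L k| <= e * `|k|) ->
  is_derive t 1 (fun s => F (T + s *: h)) (L h).
Proof.
move=> linL FL.
have LZ a : L (a *: h) = a * L h.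
  have L0 : L 0 = 0.
    by have /eqP := linL 1 0 0; rewrite scale1r addr0 mul1r -subr_eq0 opprD
      addNKr oppr_eq0 => /eqP.
  by have := linL a h 0; rewrite addr0 L0 addr0.
suff c : k^-1 *: (((fun s => F (T + s *: h)) \o shift t) (k *: 1)
           - F (T + t *: h)) @[k --> 0^'] --> L h.
  by apply: DeriveDef; [exact: cvgP c | exact: cvg_lim c].
apply/cvgrPdist_le => e e0.
have h1 : 0 < `|h| + 1 by rewrite ltr_wpDl.
have kh : k *: h @[k --> 0^'] --> (0 : H).
  rewrite -[X in _ --> X](scale0r h); apply: cvgZr_tmp.
  exact: cvg_within.
near=> k.
have k0 : k != 0 by near: k; exact: nbhs_dnbhs_neq.
have : `|F (T + t *: h + k *: h) - F (T + t *: h) - L (k *: h)|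
    <= e / (`|h| + 1) * `|k *: h|.
  by near: k; exact: kh _ (FL _ (divr_gt0 e0 h1)).
rewrite LZ /= [k%:A]mulr1 (addrC k) scalerDl addrA => FLk.
rewrite -(ler_pM2l (x := `|k|)) ?normr_gt0 // -normrM.
rewrite mulrBr mulrA divff // mul1r distrC (le_trans FLk) //.
by rewrite normrZ mulrCA ler_wpM2l // divr_add1_mul_le // ltW.
Unshelve. all: by end_near. Qed.

Section ThriceDifferentiable.
Variables (R : realType) (H : normedModType R) (f : H -> R).
Variables (f2 : H -> H -> H -> R) (f3 : H -> H -> H -> H -> R).
Hypotheses (df : forall T, differentiable f T) (df2 : is_diff2 f f2).
Hypothesis df3 : is_diff3 f2 f3.

Lemma is_derive_diff_line (T h : H) (t : R) :
  is_derive t 1 (fun s => f (T + s *: h)) ('d f (T + t *: h) h).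
Proof.
apply: is_derive_line => [a x y|e e0]; first by rewrite linearP.
have /eqaddoP/(_ e e0) := diff_locally (df (T + t *: h)).
apply: filterS => k; rewrite /= !fctE /= opprD addrA.
by rewrite (addrC k).
Qed.

Lemma is_derive_diff2_line (T h z : H) (t : R) :
  is_derive t 1 (fun s => 'd f (T + s *: h) z) (f2 (T + t *: h) h z).
Proof.
have [lin _ _ rem] := df2 (T + t *: h).
apply: (is_derive_line (F := fun X => 'd f X z) (L := f2 (T + t *: h) ^~ z)).
  exact: lin.
move=> e e0; have z1 : 0 < `|z| + 1 by rewrite ltr_wpDl.
have := rem _ (divr_gt0 e0 z1); apply: filterS => k /(_ z) /le_trans; apply.
by rewrite mulrAC ler_wpM2r // divr_add1_mul_le // ltW.
Qed.

Lemma is_derive_diff3_line (T h y z : H) (t : R) :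
  is_derive t 1 (fun s => f2 (T + s *: h) y z) (f3 (T + t *: h) h y z).
Proof.
have [lin _ _ _ rem] := df3 (T + t *: h).
apply: (is_derive_line (F := fun X => f2 X y z)
  (L := fun k => f3 (T + t *: h) k y z)).
  exact: lin.
have yz1 : 0 < `|y| * `|z| + 1 by rewrite ltr_wpDl // mulr_ge0.
move=> e e0; have := rem _ (divr_gt0 e0 yz1).
apply: filterS => k /(_ y z) /le_trans; apply.
by rewrite -(mulrA _ `|y|) mulrAC ler_wpM2r // divr_add1_mul_le // ltW.
Qed.

Lemma frechet_taylor2 (M : R) (T h : H) :
  (forall T h y z : H, `|f3 T h y z| <= M * `|h| * `|y| * `|z|) ->
  `|f (T + h) - (f T + 'd f T h + 2^-1 * f2 T h h)| <= M * `|h| ^+ 3.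
Proof.
move=> f3M.
have := @taylor2_remainder_le _ _ _ _ _ (M * `|h| ^+ 3)
  (is_derive_diff_line T h) (is_derive_diff2_line T h h)
  (is_derive_diff3_line T h h h).
rewrite scale1r scale0r addr0; apply => t _.
by rewrite !exprS expr0 mulr1 !mulrA.
Qed.

End ThriceDifferentiable.

(** * Shapes as deformations of the initial shape *)

Section Deformations.
Variables (R : realType) (d : nat) (D Omega0 : set 'rV[R]_d.+1).
Variables (H : hilbertMaps D) (J : set 'rV[R]_d.+1 -> R).
Variables (T : H) (tau : D -> D).
Hypothesis hT : invertible T tau.

Lemma map_image_deformation (F : D -> 'rV[R]_d.+1) :
  map_image F (map_image (hmap H T) Omega0) = map_image (F \o tau) Omega0.
Proof.
have [_ TE] := hT; rewrite /map_image; apply/seteqP; split => z [x /=].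
  by move=> [y yO]; rewrite TE => /val_inj <- <-; exists y.
by move=> xO <-; exists (tau x) => //=; exists x.
Qed.

(** Holds because [(I + W) o T] is [T + W o T]; perturbations of the shape thus
    become translations of [T] by [h] in the Hilbert space. *)
Lemma reduced_perturbation (W : D -> 'rV[R]_d.+1) (h : H) :
  hmap H h = W \o tau ->
  J (map_image (fun x => val x + W x) (map_image (hmap H T) Omega0))
    = reduced J Omega0 (T + h).
Proof.
move=> hW; rewrite map_image_deformation /reduced; congr (J (map_image _ _)).
by rewrite linearD hW; apply/funext => x /=; rewrite -(proj2 hT).
Qed.

(** [V o T] is [(I + V) o T - T], a difference of two elements of the space. *)
Lemma admissible_pullback (V : D -> 'rV[R]_d.+1) :
  admissible H tau V -> exists h : H, hmap H h = V \o tau.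
Proof.
move=> [_ [S SE]]; exists (S - T : H).
rewrite linearB SE; apply/funext => x /=.
by rewrite !fctE (proj2 hT) addrC addKr.
Qed.

Lemma to_hspaceK (S : H) : to_hspace H (hmap H S) = S.
Proof. by apply: xget_unique => // S' /hmap_inj. Qed.

Lemma bnorm_pullback (V : D -> 'rV[R]_d.+1) (h : H) :
  hmap H h = V \o tau -> bnorm H tau V = `|h|.
Proof. by move=> hV; rewrite /bnorm /bform -hV to_hspaceK hdot_norm. Qed.

Lemma shape_derive_reduced (V : D -> 'rV[R]_d.+1) (h : H) :
  hmap H h = V \o tau ->
  (forall X, differentiable (reduced J (H := H) Omega0) X) ->
  shape_derive J (map_image (hmap H T) Omega0) V
    = 'd (reduced J (H := H) Omega0) T h.
Proof.
move=> hV df.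
have quotE : shape_quot J (map_image (hmap H T) Omega0) V
    = rquot (fun t => reduced J Omega0 (T + (0 + t) *: h)).
  apply/funext => t; rewrite /shape_quot /rquot !add0r scale0r addr0.
  rewrite (@reduced_perturbation (fun x => t *: V x) (t *: h)) //.
  by rewrite linearZ hV.
rewrite /shape_derive quotE.
have := rderive0_shift (is_derive_diff_line df T h 0).
by rewrite scale0r addr0.
Qed.

Lemma perturbed_reduced (V : D -> 'rV[R]_d.+1) (h : H) (s1 : R) :
  hmap H h = V \o tau ->
  perturbed J (map_image (hmap H T) Omega0) V V s1
    = (fun s2 => reduced J Omega0 (T + (s1 + s2) *: h)).
Proof.
move=> hV; apply/funext => s2; rewrite /perturbed.
rewrite -(@reduced_perturbation (fun x => (s1 + s2) *: V x)).
  by congr (J (map_image _ _)); apply/funext => x; rewrite scalerDl addrA.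
by rewrite linearZ hV.
Qed.

(** On the diagonal [V = W] the field [s1 V + s2 V] is [(s1 + s2) V], so both
    derivatives are taken along the single line [T + s h]: the inner one, at
    [s1], is the first derivative of the reduced functional at [T + s1 h], and
    the outer one differentiates that at [s1 = 0]. *)
Lemma shape_derive2_reduced (f2 : H -> H -> H -> R) (V : D -> 'rV[R]_d.+1)
    (h : H) :
  hmap H h = V \o tau ->
  (forall X, differentiable (reduced J (H := H) Omega0) X) ->
  is_diff2 (reduced J (H := H) Omega0) f2 ->
  shape_derivable2 J (map_image (hmap H T) Omega0) V V /\
  shape_derive2 J (map_image (hmap H T) Omega0) V V = f2 T h h.
Proof.
move=> hV df df2.
have inner s1 : rderivable0
    (perturbed J (map_image (hmap H T) Omega0) V V s1).
  rewrite (perturbed_reduced s1 hV).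
  exact: cvgP (rquot_cvg (is_derive_diff_line df T h s1)).
have innerE : (fun s1 => rderive0
    (perturbed J (map_image (hmap H T) Omega0) V V s1))
    = (fun s1 => 'd (reduced J (H := H) Omega0) (T + (0 + s1) *: h) h).
  apply/funext => s1; rewrite (perturbed_reduced s1 hV) add0r.
  exact: rderive0_shift (is_derive_diff_line df T h s1).
have outer := is_derive_diff2_line df2 T h h 0.
rewrite /shape_derivable2 /shape_derive2 innerE; split.
  by split; [|exact: nearW|exact: cvgP (rquot_cvg outer)].
by rewrite (rderive0_shift outer) scale0r addr0.
Qed.

End Deformations.

(** * The Taylor expansion of a shape functional *)

Theorem theorem3p2 (R : realType) (d : nat)
  (D Omega0 : set 'rV[R]_d.+1)
  (hD : domain D) (hOmega0 : bounded_lipschitz_domain Omega0)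
  (hsub : Omega0 `<=` D)
  (H : hilbertMaps D) (hcomp : composition_closed H)
  (J : set 'rV[R]_d.+1 -> R)
  (hJ : shape_differentiable J H Omega0)
  (hf : thrice_differentiable_bounded (reduced J (H := H) Omega0))
  (T : H) (tau : D -> D) (hT : invertible T tau)
  (Omega : set 'rV[R]_d.+1) (hOmega : Omega = map_image (hmap H T) Omega0)
  (gradJ : H) (hgrad : is_shape_gradient J Omega tau gradJ) :
  (forall V : D -> 'rV[R]_d.+1,
     admissible H tau V -> shape_derivable2 J Omega V V) /\
  (fun V => J (map_image (fun x => val x + V x) Omega))
    = (fun V => J Omega + bform H tau (hmap H gradJ) V
                + 2^-1 * shape_derive2 J Omega V V)
      +O_ (small_fields H tau) (fun V => bnorm H tau V ^+ 3).
Proof.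
subst Omega; case: hf => df [f2 [f3 [df2 df3 [M f3M]]]].
split=> [V /(admissible_pullback hT) [h hV]|].
  by have [] := shape_derive2_reduced hT hV df df2.
apply/eqaddOP; exists M; split; first exact: num_real.
move=> k /ltW Mk; exists 1 => /=; first exact: ltr01.
move=> V [/(admissible_pullback hT) [h hV] _].
(* the gradient identity is about elements of the Hilbert space, and so needs
   V = h o T^-1 to be one; this is closure under composition with T^-1 *)
have [Z ZE] : in_hspace H V.
  have [[tau' tauK tau'K] _] := hT.
  have [_ /(_ tau' tauK tau'K) [Z ZE]] := hcomp T tau hT h.
  by exists Z; rewrite ZE hV; apply/funext => x /=; rewrite tau'K.
have -> : ((fun W => J (map_image (fun x => val x + W x)
      (map_image (hmap H T) Omega0)))
    - (fun W => J (map_image (hmap H T) Omega0)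
       + bform H tau (hmap H gradJ) W
       + 2^-1 * shape_derive2 J (map_image (hmap H T) Omega0) W W)) V
  = reduced J Omega0 (T + h) - (reduced J Omega0 T
      + 'd (reduced J (H := H) Omega0) T h + 2^-1 * f2 T h h).
  rewrite /= !fctE (reduced_perturbation _ _ hT hV).
  rewrite (proj2 (shape_derive2_reduced hT hV df df2)) -{1}ZE hgrad ZE.
  by rewrite (shape_derive_reduced hT hV df).
apply: le_trans (frechet_taylor2 df df2 df3 _ _ f3M) _.
rewrite (bnorm_pullback hV) ger0_norm ?exprn_ge0 //.
by rewrite ler_wpM2r ?exprn_ge0.
Qed.
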